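(* Let $M,\widetilde M\in\mathbb{C}^{n\times n}$ be normal matrices with eigenvalues $\lambda_j$ and $\widetilde\lambda_j$ ($j\in N=\{1,\dots,n\}$, listed with multiplicity). Let $J\subseteq N$ be nonempty and proper, and let $J^c=N\setminus J$. Suppose $\|\widetilde M-M\|_2<\frac12\,\mathrm{sep}(\lambda_J,\lambda_{J^c})$. Define $$\widehat J=\left\{j'\in N\ \middle|\ \min_{j\in N}|\widetilde\lambda_{j'}-\lambda_j|=\min_{j\in J}|\widetilde\lambda_{j'}-\lambda_j|\right\},\qquad \widehat J^c=\left\{j'\in N\ \middle|\ \min_{j\in N}|\widetilde\lambda_{j'}-\lambda_j|=\min_{j\in J^c}|\widetilde\lambda_{j'}-\lambda_j|\right\}.$$ Then: 1. $\widetilde\lambda_N$ is a separation-preserving perturbation of $\lambda_J$ and $\lambda_{J^c}$, with $\{\widetilde\lambda_{\widehat J},\widetilde\lambda_{\widehat J^c}\}$ being the separation-preserving partition of $\widetilde\lambda_N$, and $$\mathrm{sep}(\widetilde\lambda_{\widehat J},\widetilde\lambda_{\widehat J^c})\ \ge\ \mathrm{sep}(\lambda_J,\lambda_{J^c})-2\|\widetilde M-M\|_2 .$$ 2. $|\widetilde\lambda_{\widehat J}|=|\lambda_J|$ (equivalently, $|\widetilde\lambda_{\widehat J^c}|=|\lambda_{J^c}|$), where $|\cdot|$ is the number of elements of a multiset counted with multiplicity (so this says $|\widehat J|=|J|$).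
   Context: For $S\subseteq N$: $\lambda_S=\{\lambda_j\mid j\in S\}$ and $\widetilde\lambda_S=\{\widetilde\lambda_j\mid j\in S\}$, as multisets (so they have $|S|$ elements). $\|\cdot\|_2$ is the matrix norm induced by the Euclidean norm. For subsets $A,B$ of a metric space $(\Psi,d)$ (here $\Psi=\mathbb{C}$ with $d(a,b)=|a-b|$, ignoring multiplicities): $\mathrm{sep}(A,B)=\min_{a\in A,b\in B}d(a,b)$ and $d_H(A,B)=\max\left(\max_{a\in A}\min_{b\in B}d(a,b),\ \max_{b\in B}\min_{a\in A}d(a,b)\right)$ (Hausdorff distance). Separation-preserving perturbation/partition: Let $P,Q,\widetilde R$ be closed subsets of $(\Psi,d)$ and put $\widetilde P=\{r'\in\widetilde R\mid\min_{s\in P\cup Q}d(s,r')=\min_{p\in P}d(p,r')\}$, $\widetilde Q=\{r'\in\widetilde R\mid\min_{s\in P\cup Q}d(s,r')=\min_{q\in Q}d(q,r')\}$. One says $\widetilde R$ is a separation-preserving perturbation of $P$ and $Q$, and $\{\widetilde P,\widetilde Q\}$ is the separation-preserving partition of $\widetilde R$, when $\max_{r'\in\widetilde R}\min_{s\in P\cup Q}d(s,r')+d_H(P\cup Q,\widetilde R)<\mathrm{sep}(P,Q)$ and the following hold: (1) $\{\widetilde P,\widetilde Q\}$ is a partition of $\widetilde R$; (2) for all $p'\in\widetilde P$, $\arg\min_{s\in P\cup Q}d(s,p')\subseteq P$, and for all $q'\in\widetilde Q$, $\arg\min_{s\in P\cup Q}d(s,q')\subseteq Q$; (3) for all $p\in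 P$, $\arg\min_{r'\in\widetilde R}d(p,r')\subseteq\widetilde P$, and for all $q\in Q$, $\arg\min_{r'\in\widetilde R}d(q,r')\subseteq\widetilde Q$; (4) $d_H(P,\widetilde P)\le d_H(P\cup Q,\widetilde R)$, $d_H(Q,\widetilde Q)\le d_H(P\cup Q,\widetilde R)$ and $\max(d_H(P,\widetilde P),d_H(Q,\widetilde Q))=d_H(P\cup Q,\widetilde R)$; (5) (in a connected path metric space such as $\mathbb{C}$) $\mathrm{sep}(\widetilde P,\widetilde Q)\ge\mathrm{sep}(P,Q)-2\,d_H(P\cup Q,\widetilde R)$. Here $P=\lambda_J$, $Q=\lambda_{J^c}$, $\widetilde R=\widetilde\lambda_N$, $\widetilde P=\widetilde\lambda_{\widehat J}$, $\widetilde Q=\widetilde\lambda_{\widehat J^c}$. *)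

(* Defs.v *)
From HB Require Import structures.
From mathcomp Require Import all_boot all_order all_algebra.
From mathcomp Require Import complex.
From mathcomp Require Import all_classical all_reals all_analysis.

Set Implicit Arguments.
Unset Strict Implicit.
Unset Printing Implicit Defensive.

Import Order.TTheory GRing.Theory Num.Theory.
Export ComplexField.Normc(normc).

Local Open Scope classical_set_scope.
Local Open Scope ring_scope.
Local Open Scope complex_scope.

(* The modulus of [R[i]] is valued in [R[i]]; the alias [Rcomplex R] of [R[i]]
   carries the real-valued norm [normc], and we equip it with the real-valued
   metric |x - y|. *)
Section RcomplexMetric.
Variable R : realType.
Implicit Types x y z : Rcomplex R.

Let cdist x y : R := normc (x - y).

Let cdistxx x : cdist x x = 0.
Proof. by rewrite /cdist subrr ComplexField.Normc.normc0. Qed.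

Let cdist_positivity x y : cdist x y = 0 -> x = y.
Proof. by move/ComplexField.Normc.eq0_normc/eqP; rewrite subr_eq0 => /eqP. Qed.

Let cdist_sym x y : cdist x y = cdist y x.
Proof. by rewrite /cdist -[LHS]normcN opprB. Qed.

Let cdist_triangle y x z : cdist x z <= cdist x y + cdist y z.
Proof. by rewrite /cdist -(subrKA y x (- z)) le_normcD. Qed.

HB.instance Definition _ := isPointed.Build (Rcomplex R) 0.

HB.instance Definition _ := @isMetric.Build R (Rcomplex R)
  cdist cdistxx cdist_positivity cdist_sym cdist_triangle.

Lemma mdist_complexE x y : mdist x y = normc (x - y).
Proof. by []. Qed.

End RcomplexMetric.

(* [inf] and [sup] are attained, hence are a [min] and a [max], on nonempty
   finite sets of reals; both are 0 on the empty set. *)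
Definition minimum (R : realType) (T : Type) (A : set T) (f : T -> R) : R :=
  inf [set f a | a in A].

Definition maximum (R : realType) (T : Type) (A : set T) (f : T -> R) : R :=
  sup [set f a | a in A].

Definition argmin (R : realType) (T : Type) (A : set T) (f : T -> R) : set T :=
  [set a | A a /\ f a = minimum A f].

Section Separation.
Variables (R : realType) (T : metricType R).
Implicit Types A B P Q Rt Pt Qt : set T.

Definition set_dist (x : T) A : R := minimum A (fun a => mdist a x).

Definition sep A B : R := minimum (A `*` B) (fun ab => mdist ab.1 ab.2).

Definition hausdorff_dist A B : R :=
  Num.max (maximum A (fun a => set_dist a B))
          (maximum B (fun b => set_dist b A)).

Definition near_part P Q Rt : set T :=
  [set r | Rt r /\ set_dist r (P `|` Q) = set_dist r P].

(* [Rt] is a separation-preserving perturbation of [P] and [Q], with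
   separation-preserving partition [{Pt, Qt}]. The clause [sp_sep] is part of
   the notion in connected path metric spaces, such as the complex plane. *)
Record sep_preserving P Q Rt Pt Qt : Prop := {
  sp_closedP : closed P;
  sp_closedQ : closed Q;
  sp_closedR : closed Rt;
  sp_Pt : Pt = near_part P Q Rt;
  sp_Qt : Qt = near_part Q P Rt;
  sp_small : maximum Rt (fun r => set_dist r (P `|` Q))
             + hausdorff_dist (P `|` Q) Rt < sep P Q;
  sp_partition : [/\ Pt `|` Qt = Rt, Pt `&` Qt = set0, Pt !=set0 & Qt !=set0];
  sp_argmin_tilde :
    (forall p', Pt p' -> argmin (P `|` Q) (fun s => mdist s p') `<=` P) /\
    (forall q', Qt q' -> argmin (P `|` Q) (fun s => mdist s q') `<=` Q);
  sp_argmin :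
    (forall p, P p -> argmin Rt (fun r => mdist p r) `<=` Pt) /\
    (forall q, Q q -> argmin Rt (fun r => mdist q r) `<=` Qt);
  sp_hausdorff :
    [/\ hausdorff_dist P Pt <= hausdorff_dist (P `|` Q) Rt,
        hausdorff_dist Q Qt <= hausdorff_dist (P `|` Q) Rt
      & Num.max (hausdorff_dist P Pt) (hausdorff_dist Q Qt)
        = hausdorff_dist (P `|` Q) Rt];
  sp_sep : sep P Q - 2 * hausdorff_dist (P `|` Q) Rt <= sep Pt Qt
}.

End Separation.

Section Spectra.
Variables (R : realType) (n : nat).
Implicit Types (M : 'M[R[i]]_n) (lam lamt : 'I_n -> R[i]) (S J : {set 'I_n}).

Definition norm2 (x : 'cV[R[i]]_n) : R :=
  Num.sqrt (\sum_i normc (x i 0) ^+ 2).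

Definition opnorm2 M : R :=
  sup [set norm2 (M *m x) | x in [set x | norm2 x = 1]].

Definition eigenvalues_of M lam : Prop :=
  char_poly M = \prod_(j < n) ('X - (lam j)%:P).

(* The multiset of the [lam j], [j \in S], as a list of length [#|S|]. *)
Definition subspectrum lam S : seq R[i] := [seq lam j | j in S].

Definition subspectrum_set lam S : set (Rcomplex R) :=
  [set z | z \in subspectrum lam S].

Definition closest lam lamt J : {set 'I_n} :=
  [set j' | minimum [set: 'I_n] (fun j => normc (lamt j' - lam j))
            == minimum [set` J] (fun j => normc (lamt j' - lam j))]%SET.

End Spectra.

(* Main.v *)
Require Import Defs.
From mathcomp Require Import all_boot all_order all_algebra.
From mathcomp Require Import complex.
From mathcomp Require Import all_classical all_reals all_analysis.
From mathcomp Require Import finmap ring lra.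

Set Implicit Arguments.
Unset Strict Implicit.
Unset Printing Implicit Defensive.

Import Order.TTheory GRing.Theory Num.Theory numFieldNormedType.Exports.
Local Open Scope classical_set_scope.
Local Open Scope ring_scope.
Local Open Scope complex_scope.
Local Open Scope sesquilinear_scope.

(** All eigenvalues of [M + t (Mt - M)], [0 <= t <= 1], lie within
    [e := opnorm2 (Mt - M)] of the spectrum of the normal matrix [M]
    (Bauer-Fike). As [2 e < sep P Q], the discs of radius [e] around [P] and
    those around [Q] form disjoint compact sets, so the number of eigenvalues
    in each of them, being a locally constant function of [t], is the same for
    [M] and [Mt]. Exchanging [M] and [Mt] in Bauer-Fike bounds the Hausdorff
    distance of the spectra by [e]; the clauses of a separation-preserving
    perturbation then follow from the triangle inequality, since a point of the
    perturbed spectrum belongs to the part of [P] iff it is [e]-close to [P]. *)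

(** * Finite separation-preserving perturbations *)

Section FiniteExtrema.
Variables (R : realType) (T : choiceType).
Implicit Types (A : set T) (f : T -> R).

(** Source of the facts below on [minimum] and [maximum]: attainment supplies the bounds that [inf]
    and [sup] require, the case of [sup] by passing to [- f]. *)
Lemma finite_argmin A f : finite_set A -> A !=set0 ->
  exists2 a, A a & forall b, A b -> f a <= f b.
Proof.
move=> /finite_fsetP[X ->] [x xX].
case: (@arg_minP _ _ _ [` xX]%fset xpredT (fun a => f (val a)) isT) => a _ h.
by exists (val a) => [|b bX]; [exact: valP | exact: (h [` bX]%fset)].
Qed.

Lemma minimumP A f : finite_set A -> A !=set0 ->
  exists2 a, A a & f a = minimum A f.
Proof.
move=> finA A0; have [a Aa amin] := finite_argmin f finA A0.
exists a => //; rewrite /minimum.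
have lb : lbound [set f b | b in A] (f a) by move=> _ [b Ab <-]; exact: amin.
apply/eqP; rewrite eq_le lb_le_inf//=; last by exists (f a), a.
by apply: ge_inf; [exists (f a) | exists a].
Qed.

Lemma ge_minimum A f a : finite_set A -> A a -> minimum A f <= f a.
Proof.
move=> finA Aa; have [|b _ bmin] := finite_argmin f finA _; first by exists a.
apply: ge_inf; last by exists a.
by exists (f b) => _ [c Ac <-]; exact: bmin.
Qed.

Lemma le_minimum A f (e : R) : A !=set0 ->
  (forall a, A a -> e <= f a) -> e <= minimum A f.
Proof.
move=> [a Aa] h; apply: lb_le_inf; first by exists (f a), a.
by move=> _ [b Ab <-]; exact: h.
Qed.

Lemma le_maximum A f a : finite_set A -> A a -> f a <= maximum A f.
Proof.
move=> finA Aa.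
have [|b _ bmax] := finite_argmin (fun x => - f x) finA _; first by exists a.
apply: ub_le_sup; last by exists a.
by exists (f b) => _ [c Ac <-]; rewrite -lerN2 bmax.
Qed.

Lemma ge_maximum A f (e : R) : A !=set0 ->
  (forall a, A a -> f a <= e) -> maximum A f <= e.
Proof.
move=> [a Aa] h; apply: ge_sup; first by exists (f a), a.
by move=> _ [b Ab <-]; exact: h.
Qed.

End FiniteExtrema.

Section SeparationPreserving.
Variables (R : realType) (T : metricType R).
Implicit Types (A B P Q S : set T).

Lemma set_dist_le A x (e : R) : finite_set A -> A !=set0 ->
  set_dist x A <= e <-> exists2 a, A a & mdist a x <= e.
Proof.
move=> finA A0; split=> [h|[a Aa]]; last by apply: le_trans; exact: ge_minimum.
have [a Aa aE] := minimumP (fun a => mdist a x) finA A0.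
by exists a => //; rewrite aE.
Qed.

(** Turns a Hausdorff bound into the existence of partners, so that the later arguments only use the
    triangle inequality. *)
Lemma hausdorff_dist_le A B (e : R) : finite_set A -> finite_set B ->
  A !=set0 -> B !=set0 ->
  hausdorff_dist A B <= e <->
  (forall a, A a -> exists2 b, B b & mdist a b <= e) /\
  (forall b, B b -> exists2 a, A a & mdist a b <= e).
Proof.
move=> fA fB A0 B0; rewrite /hausdorff_dist ge_max; split.
  move=> /andP[hA hB]; split=> x Xx.
    have /(set_dist_le _ _ fB B0)[b] := le_trans (le_maximum _ fA Xx) hA.
    by exists b => //; rewrite metric_sym.
  exact/(set_dist_le _ _ fA A0)/(le_trans (le_maximum _ fB Xx) hB).
move=> [hA hB]; apply/andP; split; apply: ge_maximum => // x Xx.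
  have [b Bb h] := hA _ Xx; apply/set_dist_le => //; exists b => //.
  by rewrite metric_sym.
by have [a Aa h] := hB _ Xx; apply/set_dist_le => //; exists a.
Qed.

(** If some [p] is within [h] of [r], each [s] in [Q] satisfies [mdist r s >= sep P Q - h > h], so
    the nearest point lies in [P]. Conversely, the distance to [P], being the distance to the union,
    is at most [h], and it is attained. *)
Lemma near_partP P Q S (h : R) r : finite_set P -> finite_set Q ->
  P !=set0 -> Q !=set0 ->
  (forall r, S r -> exists2 s, (P `|` Q) s & mdist s r <= h) ->
  2 * h < sep P Q ->
  near_part P Q S r <-> S r /\ exists2 p, P p & mdist p r <= h.
Proof.
move=> fP fQ P0 Q0 near hsep.
have fPQ : finite_set (P `|` Q) by rewrite finite_setU.
have PQ0 : (P `|` Q) !=set0 by case: P0 => p; exists p; left.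
split=> -[Sr].
  move=> E; split=> //; apply/set_dist_le => //; rewrite -E.
  by apply/set_dist_le => //; exact: near.
move=> [p Pp hp]; split=> //; rewrite /set_dist.
apply/eqP; rewrite eq_le; apply/andP; split.
  have [a Pa <-] := minimumP (fun a => mdist a r) fP P0.
  by apply: ge_minimum => //; left.
apply: le_minimum => // s [Ps|Qs]; first exact: ge_minimum.
apply: (@le_trans _ _ (mdist p r)); first exact: ge_minimum.
have : sep P Q <= mdist p s.
  by apply: (@ge_minimum _ _ _ _ (p, s)) => //; exact: finite_setX.
by have := metric_triangle p r s; rewrite [mdist r s]metric_sym; lra.
Qed.

Lemma near_part_disj P Q (h : R) p q r : finite_set P -> finite_set Q ->
  2 * h < sep P Q -> P p -> Q q -> mdist p r <= h -> mdist q r <= h -> False.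
Proof.
move=> fP fQ hsep Pp Qq hp hq.
have : sep P Q <= mdist p q.
  by apply: (@ge_minimum _ _ _ _ (p, q)) => //; exact: finite_setX.
by have := metric_triangle p r q; rewrite [mdist r q]metric_sym; lra.
Qed.


Lemma sepC P Q : sep P Q = sep Q P.
Proof.
rewrite /sep /minimum; congr inf; apply/seteqP.
by split=> _ [[a b] [/= Aa Bb] <-]; exists (b, a) => //=; rewrite metric_sym.
Qed.

(** * Clauses for one half of the partition; exchanging [P] and [Q] gives the other half *)

Section HalfPerturbation.
Variables (P Q S : set T) (h : R).
Hypotheses (fP : finite_set P) (fQ : finite_set Q) (fS : finite_set S).
Hypotheses (P0 : P !=set0) (Q0 : Q !=set0) (S0 : S !=set0).
Hypotheses (leh : hausdorff_dist (P `|` Q) S <= h) (hsep : 2 * h < sep P Q).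

Let fPQ : finite_set (P `|` Q). Proof. by rewrite finite_setU. Qed.
Let PQ0 : (P `|` Q) !=set0. Proof. by case: P0 => p; exists p; left. Qed.

Let nearS r : S r -> exists2 s, (P `|` Q) s & mdist s r <= h.
Proof. by have /hausdorff_dist_le[//|//|//|//|_] := leh; exact. Qed.

Let nearPQ s : (P `|` Q) s -> exists2 r, S r & mdist s r <= h.
Proof. by have /hausdorff_dist_le[//|//|//|//|+ _] := leh; exact. Qed.

Let inP r : near_part P Q S r <-> S r /\ exists2 p, P p & mdist p r <= h.
Proof. exact: near_partP. Qed.

Let inQ r : near_part Q P S r <-> S r /\ exists2 p, Q p & mdist p r <= h.
Proof.
by apply: near_partP; rewrite // 1?sepC// => r' /nearS[s]; rewrite setUC; exists s.
Qed.

Lemma near_part_neq0 : near_part P Q S !=set0.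
Proof.
have [p Pp] := P0; have [r Sr pr] := nearPQ (or_introl Pp).
by exists r; apply/inP; split=> //; exists p.
Qed.

(** A minimiser in [Q] would be within [h] of [p'], as is some point of [P]; this forces
    [sep P Q <= 2 * h]. *)
Lemma argmin_near_part p' : near_part P Q S p' ->
  argmin (P `|` Q) (fun s => mdist s p') `<=` P.
Proof.
move=> Pp' s [[//|Qs] sE].
have [Sp' [p Pp pp']] := (inP p').1 Pp'.
have sp' : mdist s p' <= h.
  by rewrite sE; apply: le_trans pp'; apply: ge_minimum => //; left.
by case: (near_part_disj fP fQ hsep Pp Qs pp' sp').
Qed.

Lemma argmin_subset_near_part p : P p ->
  argmin S (fun r => mdist p r) `<=` near_part P Q S.
Proof.
move=> Pp r [Sr rE]; apply/inP; split=> //; exists p => //.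
rewrite rE; have [r' Sr' pr'] := nearPQ (or_introl Pp).
by apply: le_trans pr'; exact: ge_minimum.
Qed.

Lemma hausdorff_dist_near_part :
  hausdorff_dist P (near_part P Q S) <= h.
Proof.
apply/hausdorff_dist_le => //; last split=> [p Pp|r /inP[_]//].
- by apply: sub_finite_set fS => r [].
- exact: near_part_neq0.
- have [r Sr pr] := nearPQ (or_introl Pp).
  by exists r => //; apply/inP; split=> //; exists p.
Qed.

(** For [a] and [b] in the two parts, with partners [p] and [q], the path [p, a, b, q] gives
    [sep P Q <= h + mdist a b + h]. *)
Lemma near_part_sep :
  sep P Q - 2 * h <= sep (near_part P Q S) (near_part Q P S).
Proof.
apply: le_minimum.
  have [p Pp] := near_part_neq0; have [q Qq] := Q0.
  have [r Sr qr] := nearPQ (or_intror Qq).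
  by exists (p, r); split=> //=; apply/inQ; split=> //; exists q.
move=> [a b] [/= /inP[_ [p Pp pa]] /inQ[_ [q Qq qb]]].
have : sep P Q <= mdist p q.
  by apply: (@ge_minimum _ _ _ _ (p, q)) => //; exact: finite_setX.
have := metric_triangle p a q; have := metric_triangle a b q.
by rewrite [mdist b q]metric_sym; lra.
Qed.

Lemma near_partU : near_part P Q S `|` near_part Q P S = S.
Proof.
apply/seteqP; split=> r; first by move=> [[]|[]].
move=> Sr; have [s [Ps|Qs] sr] := nearS Sr; [left; apply/inP|right; apply/inQ];
  by split=> //; exists s.
Qed.

Lemma near_partI : near_part P Q S `&` near_part Q P S = set0.
Proof.
apply/seteqP; split=> // r [/inP[_ [p Pp pr]] /inQ[_ [q Qq qr]]].
exact: (near_part_disj fP fQ hsep Pp Qq pr qr).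
Qed.

End HalfPerturbation.

Lemma sep_preserving_finite P Q S :
  finite_set P -> finite_set Q -> finite_set S ->
  P !=set0 -> Q !=set0 -> S !=set0 ->
  2 * hausdorff_dist (P `|` Q) S < sep P Q ->
  sep_preserving P Q S (near_part P Q S) (near_part Q P S).
Proof.
move=> fP fQ fS P0 Q0 S0 hPQ.
have hQP : 2 * hausdorff_dist (Q `|` P) S < sep Q P by rewrite setUC sepC.
have fcl : forall A, finite_set A -> closed A.
  by have /accessible_finite_set_closed := hausdorff_accessible (@metric_hausdorff _ T).
have fPQ : finite_set (P `|` Q) by rewrite finite_setU.
have PQ0 : (P `|` Q) !=set0 by case: P0 => p; exists p; left.
have Pt0 : near_part P Q S !=set0 by exact: near_part_neq0 hPQ.
have Qt0 : near_part Q P S !=set0 by exact: near_part_neq0 hQP.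
have fPt : finite_set (near_part P Q S) by apply: sub_finite_set fS => r [].
have fQt : finite_set (near_part Q P S) by apply: sub_finite_set fS => r [].
have lePt : hausdorff_dist P (near_part P Q S) <= hausdorff_dist (P `|` Q) S.
  exact: hausdorff_dist_near_part hPQ.
have leQt : hausdorff_dist Q (near_part Q P S) <= hausdorff_dist (P `|` Q) S.
  by rewrite setUC; exact: hausdorff_dist_near_part hQP.
have SE : near_part P Q S `|` near_part Q P S = S by exact: near_partU hPQ.
split=> //; try exact: fcl.
(* This maximum is one of the two terms of the Hausdorff distance, so the sum in [sp_small] is at
   most twice that distance. *)
- have : maximum S (fun r => set_dist r (P `|` Q)) <= hausdorff_dist (P `|` Q) S.
    by rewrite /hausdorff_dist le_max lexx orbT.
  by move: hPQ; lra.
- by split=> //; exact: near_partI hPQ.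
- split=> p; first exact: (argmin_near_part fP fQ fS P0 Q0 S0 (lexx _) hPQ).
  by rewrite setUC; exact: (argmin_near_part fQ fP fS Q0 P0 S0 (lexx _) hQP).
- split=> p; first exact: (argmin_subset_near_part fP fQ fS P0 Q0 S0 (lexx _) hPQ).
  exact: (argmin_subset_near_part fQ fP fS Q0 P0 S0 (lexx _) hQP).
- split=> //; apply/eqP; rewrite eq_le ge_max lePt leQt /=.
  (* Remaining inequality: every point of [P], [Q] or [S] belongs to one of the halves, and has
     there a partner at distance at most [m]. *)
  set m := Num.max _ _.
  have [PtS PPt] : (forall p, P p -> exists2 r, near_part P Q S r & mdist p r <= m) /\
      (forall r, near_part P Q S r -> exists2 p, P p & mdist p r <= m).
    by apply/hausdorff_dist_le; rewrite // /m le_max lexx.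
  have [QtS QQt] : (forall q, Q q -> exists2 r, near_part Q P S r & mdist q r <= m) /\
      (forall r, near_part Q P S r -> exists2 q, Q q & mdist q r <= m).
    by apply/hausdorff_dist_le; rewrite // /m le_max lexx orbT.
  apply/hausdorff_dist_le => //; split=> [s [Ps|Qs]|r].
  + by have [r [Sr _] ?] := PtS _ Ps; exists r.
  + by have [r [Sr _] ?] := QtS _ Qs; exists r.
  + rewrite -SE => -[/PPt|/QQt] [s ? ?]; exists s => //; [by left|by right].
- exact: near_part_sep hPQ.
Qed.

End SeparationPreserving.

(** * The Bauer-Fike theorem *)

Section EuclideanNorm.
Variables (R : realType).
Local Notation C := R[i].

Lemma normr_normc (z : C) : `|z| = (normc z)%:C.
Proof. by case: z. Qed.

Lemma normc_ge0 (z : C) : 0 <= normc z.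
Proof. by rewrite -lecR -normr_normc normr_ge0. Qed.

Lemma normc_real (a : R) : normc a%:C = `|a|.
Proof. by rewrite /= expr0n addr0 sqrtr_sqr. Qed.

Lemma normcM (x y : C) : normc (x * y) = normc x * normc y.
Proof. exact: ComplexField.Normc.normcM. Qed.

Lemma normc_eq0 (z : C) : (normc z == 0) = (z == 0).
Proof.
apply/eqP/eqP => [|->]; first exact: ComplexField.Normc.eq0_normc.
exact: ComplexField.Normc.normc0.
Qed.

Lemma ler_normcD (x y : C) : normc (x + y) <= normc x + normc y.
Proof. exact: le_normcD. Qed.

Lemma ler_normc_sum (I : Type) (r : seq I) (F : I -> C) :
  normc (\sum_(i <- r) F i) <= \sum_(i <- r) normc (F i).
Proof.
elim/big_rec2: _ => [|i a x _ h]; first by rewrite ComplexField.Normc.normc0.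
by apply: le_trans (ler_normcD _ _) _; rewrite lerD2l.
Qed.

Section Vectors.
Variable n : nat.
Implicit Types (x y : 'cV[C]_n).

Lemma norm2_sqr x : norm2 x ^+ 2 = \sum_i normc (x i 0) ^+ 2.
Proof. by rewrite sqr_sqrtr// sumr_ge0// => i _; rewrite sqr_ge0. Qed.

Lemma norm2_ge0 x : 0 <= norm2 x.
Proof. exact: sqrtr_ge0. Qed.

Lemma norm2_eq0 x : (norm2 x == 0) = (x == 0).
Proof.
rewrite -sqrf_eq0 norm2_sqr psumr_eq0; last by move=> i _; rewrite sqr_ge0.
apply/allP/eqP => [h|-> i _]; last by rewrite mxE sqrf_eq0 normc_eq0 eqxx.
apply/matrixP => i j; rewrite ord1 mxE.
by have /(_ (mem_index_enum i)) := h i; rewrite /= sqrf_eq0 normc_eq0 => /eqP.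
Qed.

Lemma norm2Z (a : C) x : norm2 (a *: x) = normc a * norm2 x.
Proof.
apply/eqP; rewrite -(@eqrXn2 _ 2) ?mulr_ge0 ?norm2_ge0 ?normc_ge0//.
rewrite exprMn !norm2_sqr mulr_sumr; apply/eqP.
by apply: eq_bigr => i _; rewrite mxE normcM exprMn.
Qed.

Lemma norm2N x : norm2 (- x) = norm2 x.
Proof.
suff n1 : normc (-1 : C) = 1 by rewrite -scaleN1r norm2Z n1 mul1r.
by apply: complexI; rewrite -normr_normc normrN1.
Qed.

(** In this form, invariance under a unitary matrix is the cancellation of its adjoint against
    it. *)
Lemma norm2_dot x : (norm2 x ^+ 2)%:C = (x ^t* *m x) 0 0.
Proof.
rewrite norm2_sqr rmorph_sum mxE; apply: eq_bigr => i _.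
by rewrite !mxE rmorphXn/= -normr_normc normCK mulrC.
Qed.

Lemma norm2_unitary (P : 'M[C]_n) x : P \is unitarymx -> norm2 (P *m x) = norm2 x.
Proof.
move=> Pu; apply/eqP; rewrite -(@eqrXn2 _ 2) ?norm2_ge0//; apply/eqP.
apply: complexI; rewrite !norm2_dot trmx_mul map_mxM -mulmxA (mulmxA _ P).
by rewrite -(invmx_unitary Pu) (mulVmx (unitarymx_unit Pu)) mul1mx.
Qed.

End Vectors.

(** Normalising [x] reduces this to an upper bound by a supremum, which requires the set of values
    to be bounded: [sup] is 0 by default otherwise. *)
Lemma opnorm2P n (G : 'M[C]_n) x : norm2 (G *m x) <= opnorm2 G * norm2 x.
Proof.
have [->|x0] := eqVneq x 0.
  have n0 : norm2 (0 : 'cV[C]_n) = 0 by apply/eqP; rewrite norm2_eq0.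
  by rewrite mulmx0 n0 mulr0.
have nx0 : 0 < norm2 x by rewrite lt_neqAle eq_sym norm2_eq0 x0 norm2_ge0.
rewrite -ler_pdivrMr// mulrC.
have -> : (norm2 x)^-1 * norm2 (G *m x) = norm2 (G *m ((norm2 x)^-1%:C *: x)).
  by rewrite -scalemxAr norm2Z normc_real ger0_norm// invr_ge0 ltW.
apply: ub_le_sup; last first.
  exists ((norm2 x)^-1%:C *: x) => //=.
  by rewrite norm2Z normc_real ger0_norm ?invr_ge0 ?ltW// mulVf// gt_eqF.
(* The coordinates of a unit vector have modulus at most 1, so each coordinate of [G *m y] is
   bounded by the absolute row sum of [G]. *)
exists (Num.sqrt (\sum_i (\sum_j normc (G i j)) ^+ 2)) => _ [y /= ny <-].
rewrite ler_sqrt ?sumr_ge0// => [|i _]; last exact: sqr_ge0.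
apply: ler_sum => i _; rewrite ler_sqr ?nnegrE ?normc_ge0 ?sumr_ge0//; last first.
  by move=> j _; exact: normc_ge0.
rewrite mxE.
apply: (@le_trans _ _ (\sum_j normc (G i j * y j 0))).
  exact: ler_normc_sum.
apply: ler_sum => j _; rewrite normcM ler_piMr ?normc_ge0//.
rewrite -(@ler_pXn2r _ 2) ?nnegrE ?normc_ge0// expr1n.
suff : normc (y j 0) ^+ 2 <= norm2 y ^+ 2 by rewrite ny expr1n.
by rewrite norm2_sqr (bigD1 j)//= lerDl sumr_ge0// => k _; rewrite sqr_ge0.
Qed.

Lemma horner_char_poly n (A : 'M[C]_n) (z : C) : (char_poly A).[z] = \det (z%:M - A).
Proof.
rewrite /char_poly -[_.[z]]/(horner_eval z _) -det_map_mx; congr (\det _).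
apply/matrixP => i j; rewrite !mxE /= /horner_eval.
by rewrite hornerD hornerN hornerC hornerMn hornerX.
Qed.

Lemma eigenvalues_ofP n (A : 'M[C]_n) lam (z : C) : eigenvalues_of A lam ->
  \det (z%:M - A) = 0 <-> exists j, z = lam j.
Proof.
move=> h; rewrite -horner_char_poly h horner_prod; split=> [/eqP|[j ->]].
  rewrite prodf_seq_eq0 => /hasP[j _ /=]; rewrite hornerXsubC subr_eq0 => /eqP.
  by exists j.
by rewrite (bigD1 j)//= hornerXsubC subrr mul0r.
Qed.

Lemma exists_eigenvalues n (A : 'M[C]_n) : exists lam, eigenvalues_of A lam.
Proof.
have [r rE] := closed_field_poly_normal (char_poly A).
have sr : size r = n.
  have := size_char_poly A; rewrite rE (monicP (char_poly_monic A)) scale1r.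
  by rewrite size_prod_XsubC => -[].
exists (fun i => r`_i); rewrite /eigenvalues_of {1}rE.
by rewrite (monicP (char_poly_monic A)) scale1r (big_nth 0) sr big_mkord.
Qed.

(* In an orthonormal eigenbasis of [M], [M x - mu x] has coordinates
   [(d_i - mu) y_i], so its norm bounds [|x|] times the distance from [mu] to
   the spectrum of [M]. *)
Lemma bauer_fike n (M G : 'M[C]_n) lam (e : R) (mu : C) :
  M \is normalmx -> eigenvalues_of M lam ->
  (forall x, norm2 (G *m x) <= e * norm2 x) ->
  \det (mu%:M - (M + G)) = 0 -> exists j, normc (mu - lam j) <= e.
Proof.
(* [det0P] gives a row vector in the left kernel; transposing before and after gives a column
   eigenvector [x]. *)
move=> nM lamE Ge; rewrite -det_tr => /eqP/det0P[v v0 /(congr1 trmx)].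
rewrite trmx_mul trmxK trmx0; set x := v^T => xE.
have x0 : x != 0.
  by rewrite -(trmxK v) -/x in v0; apply: contraNneq v0 => ->; rewrite trmx0.
have [P [d [Pu ME]]] : exists (P : 'M[C]_n) (d : 'rV[C]_n),
    P \is unitarymx /\ M = invmx P *m diag_mx d *m P.
  exists (spectralmx M), (spectral_diag M).
  by split; [exact: spectral_unitarymx | exact/orthomx_spectralP].
have Punit : P \in unitmx by exact: unitarymx_unit.
have GxE : P *m (G *m x) = (mu%:M - diag_mx d) *m (P *m x).
  have -> : G *m x = mu%:M *m x - M *m x.
    by move: xE; rewrite mulmxBl mulmxDl => /subr0_eq ->; rewrite addrC addKr.
  rewrite mulmxBr mulmxBl; congr (_ - _); first by rewrite !mul_scalar_mx scalemxAr.
  have PM : P *m M = diag_mx d *m P by rewrite ME -mulmxA mulKVmx.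
  by rewrite [LHS]mulmxA PM mulmxA.
(* [d 0 i - M] is similar to a diagonal matrix whose entry at [i] vanishes. *)
have dE i : exists j, d 0 i = lam j.
  apply/(eigenvalues_ofP _ lamE).
  have -> : (d 0 i)%:M - M = invmx P *m ((d 0 i)%:M - diag_mx d) *m P.
    by rewrite mulmxBr mulmxBl -ME scalar_mxC -mulmxA mulVmx// mulmx1.
  rewrite !det_mulmx -diag_const_mx -raddfB/= det_diag (bigD1 i)//= !mxE subrr.
  by rewrite mul0r mulr0 mul0r.
have nx0 : 0 < norm2 x by rewrite lt_neqAle eq_sym norm2_eq0 x0 norm2_ge0.
have e0 : 0 <= e by have := le_trans (norm2_ge0 _) (Ge x); rewrite pmulr_lge0.
apply: contrapT => far.
have {}far i : e < normc (mu - d 0 i).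
  by have [j ->] := dE i; rewrite ltNge; apply/negP => ?; apply: far; exists j.
have := Ge x; rewrite -(norm2_unitary _ Pu) GxE -(norm2_unitary x Pu).
rewrite leNgt => /negP; apply; set y := P *m x.
(* The squared norms are compared coordinatewise; a nonzero coordinate [k] makes the sum inequality
   strict. *)
have /cV0Pn[k yk] : y != 0 by rewrite -norm2_eq0 norm2_unitary// gt_eqF.
rewrite -(@ltr_pXn2r _ 2) ?nnegrE ?mulr_ge0 ?norm2_ge0// exprMn !norm2_sqr mulr_sumr.
have entry (w : 'cV[C]_n) i : ((mu%:M - diag_mx d) *m w) i 0 = (mu - d 0 i) * w i 0.
  rewrite mulmxBl mul_scalar_mx mul_diag_mx !mxE; by rewrite mulrBl.
rewrite (bigD1 k)//= [ltRHS](bigD1 k)//= ltr_leD//.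
  rewrite entry normcM exprMn ltr_pM2r ?ltr_pXn2r ?nnegrE ?normc_ge0//.
  by rewrite exprn_gt0// lt_neqAle eq_sym normc_eq0 yk normc_ge0.
apply: ler_sum => i _; rewrite entry normcM exprMn ler_wpM2r ?sqr_ge0//.
by rewrite ler_pXn2r ?nnegrE ?normc_ge0// ltW.
Qed.

End EuclideanNorm.

(** * Continuity of the number of roots *)

Lemma continuous_fst (T U : topologicalType) : continuous (@fst T U).
Proof. by move=> x; exact: (@cvg_fst _ _ (nbhs x.1) (nbhs x.2)). Qed.

Lemma continuous_snd (T U : topologicalType) : continuous (@snd T U).
Proof. by move=> x; exact: (@cvg_snd _ _ (nbhs x.1) (nbhs x.2)). Qed.

Lemma closed_eqfun (T : topologicalType) (K : numFieldType) (f g : T -> K) :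
  continuous f -> continuous g -> closed [set x | f x = g x].
Proof.
move=> cf cg.
have -> : [set x | f x = g x] = (fun x => f x - g x) @^-1` [set 0].
  apply/seteqP; split=> x /=; first by move=> ->; rewrite subrr.
  by move/subr0_eq.
apply: closed_comp => [x _|]; first exact: cvgB (cf x) (cg x).
by apply: accessible_closed_set1; exact: hausdorff_accessible (@norm_hausdorff _ _).
Qed.

(** In characteristic 0 the integers below [size (p - q)] are distinct; they are as many roots of
    [p - q] as its size, more than its degree allows. *)
Lemma horner_inj (K : numFieldType) (p q : {poly K}) :
  (forall z, p.[z] = q.[z]) -> p = q.
Proof.
move=> pq; apply: subr0_eq.
pose rs : seq K := [seq i%:R | i <- iota 0 (size (p - q))].
apply: (@roots_geq_poly_eq0 _ _ rs); last by rewrite size_map size_iota.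
  by apply/allP => z _; rewrite /root hornerD hornerN pq subrr.
by rewrite map_inj_uniq ?iota_uniq// => i j /eqP; rewrite eqr_nat => /eqP.
Qed.

Lemma count_roots (K : fieldType) n (v w : 'I_n -> K) (a : pred K) :
  \prod_i ('X - (v i)%:P) = \prod_i ('X - (w i)%:P) ->
  #|[set i | a (v i)]%SET| = #|[set i | a (w i)]%SET|.
Proof.
have countE (u : 'I_n -> K) :
    #|[set i | a (u i)]%SET| = count a [seq u i | i <- index_enum 'I_n].
  by rewrite -sum1_count big_map -sum1_card; apply: eq_bigl => i; rewrite inE.
have prodE (u : 'I_n -> K) :
    \prod_i ('X - (u i)%:P) = \prod_(x <- [seq u i | i <- index_enum 'I_n]) ('X - x%:P).
  by rewrite big_map.
by rewrite !prodE !countE => vw; have /seq.permP := prod_XsubC_eq vw; exact.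
Qed.

Section RootCount.
Variables (R : realType) (K : numFieldType) (n : nat) (p : R -> {poly K}).
Variables (A B : set K).
Hypothesis cp : forall z, continuous (fun t => (p t).[z]).
Hypotheses (cA : compact A) (cB : compact B) (AB : A `&` B = set0).

Let I01 : set R := `[0, 1].

Let has_roots_in (S : {set 'I_n}) : set R :=
  [set t | I01 t /\ exists v : 'I_n -> K, p t = \prod_i ('X - (v i)%:P) /\
    forall i, (if i \in S then A else B) (v i)].

(** The box [L] of parameters and root vectors is compact by Tychonoff. Equality of polynomials is
    tested at every [z], each test being a closed condition on the pair, so [E] is closed. The
    projection of the intersection is compact, hence closed. *)
Let closed_has_roots_in S : closed (has_roots_in S).
Proof.
pose L : set (R * {ptws 'I_n -> K}) :=
  I01 `*` [set v | forall i, (if i \in S then A else B) (v i)].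
pose E : set (R * {ptws 'I_n -> K}) :=
  \bigcap_(z in [set: K]) [set x | (p x.1).[z] = \prod_i (z - x.2 i)].
have fstc : continuous (fst : R * {ptws 'I_n -> K} -> R).
  by move=> x; exact: continuous_fst.
have sndc : continuous (snd : R * {ptws 'I_n -> K} -> {ptws 'I_n -> K}).
  by move=> x; exact: continuous_snd.
have -> : has_roots_in S = fst @` (L `&` E).
  apply/seteqP; split=> t.
    move=> [It [v [pt vS]]]; exists (t, v) => //; split=> // z _ /=.
    by rewrite pt horner_prod; apply: eq_bigr => i _; rewrite hornerXsubC.
  move=> [[s v] [[/= It vS] Ev] <-]; split=> //; exists v; split=> //.
  apply: horner_inj => z; rewrite [LHS](Ev z I) horner_prod.
  by apply: eq_bigr => i _; rewrite hornerXsubC.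
apply: compact_closed; first exact: norm_hausdorff.
apply: continuous_compact; first exact: continuous_subspaceT.
apply: compact_closedI.
  apply: compact_setX; first exact: segment_compact.
  apply: (@tychonoff 'I_n (fun=> K) (fun i => if i \in S then A else B)) => i;
    by case: ifP.
apply: closed_bigI => z _; apply: closed_eqfun.
  move=> x; apply: (@cvg_comp _ _ _ fst (fun t => (p t).[z])); first exact: fstc.
  exact: cp.
apply: continuous_big => [|i _ x]; first exact: mul_continuous.
have projc : (fun y : R * {ptws 'I_n -> K} => y.2 i) y @[y --> x] --> x.2 i.
  apply: (@cvg_comp _ _ _ snd (fun v : {ptws 'I_n -> K} => v i)); first exact: sndc.
  exact: (@proj_continuous 'I_n (fun=> K)).
exact: (cvgB (cvg_cst z) projc).
Qed.

Let count_in (v : 'I_n -> K) := #|[set i | `[< A (v i) >]]%SET|.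

(* For each index set [S], the parameters at which the roots can be numbered so
   that exactly those with index in [S] lie in [A] form a closed set, as the
   projection of a compact set; grouping by the cardinal of [S] splits the
   segment into disjoint closed sets. *)
Lemma root_count_const (v w : 'I_n -> K) :
  (forall t, I01 t -> exists u : 'I_n -> K,
     p t = \prod_i ('X - (u i)%:P) /\ forall i, A (u i) \/ B (u i)) ->
  p 0 = \prod_i ('X - (v i)%:P) -> p 1 = \prod_i ('X - (w i)%:P) ->
  count_in v = count_in w.
Proof.
move=> roots pv pw.
pose W (P : pred {set 'I_n}) := \bigcup_(S in [set S | P S]) has_roots_in S.
have clW P : closed (W P).
  by apply: closed_bigcup => [|S _]; [exact: finite_finset | exact: closed_has_roots_in].
(* As [A] and [B] are disjoint, the numbering witnessing [S] has exactly the indices of [S] in [A];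
   [count_roots] carries the count over to [u]. *)
have countW P t u : W P t -> p t = \prod_i ('X - (u i)%:P) ->
    exists2 S, P S & #|S| = count_in u.
  move=> [S PS [_ [x [-> xS]]]] /count_roots xu; exists S => //.
  rewrite /count_in -(xu (fun z => `[< A z >])); apply: eq_card => i; rewrite inE.
  have := xS i; case: ifP => _ h; apply/esym; first exact/asboolP.
  apply/asboolP => Ai; suff : set0 (x i) by [].
  by rewrite -AB.
pose k := count_in v; pose P1 (S : {set 'I_n}) := #|S| == k.
pose P2 (S : {set 'I_n}) := #|S| != k.
have cover t : I01 t -> (W P1 `|` W P2) t.
  move=> It; have [u [pu uAB]] := roots _ It.
  pose S := [set i | `[< A (u i) >]]%SET.
  have tS : has_roots_in S t.
    split=> //; exists u; split=> // i; rewrite inE.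
    by case: asboolP => // nA; case: (uAB i).
  by have [PS|nPS] := boolP (P1 S); [left|right]; exists S.
have disj : W P1 `&` W P2 = set0.
  apply/seteqP; split=> // t [W1 W2].
  have [S _ [It [u [pu _]]]] := W1.
  have [S1 /eqP S1k S1u] := countW _ _ _ W1 pu.
  have [S2 /eqP S2k S2u] := countW _ _ _ W2 pu.
  by apply: S2k; rewrite S2u -S1u.
(* Disjoint closed sets are separated, so one of them contains the connected segment. In [W P1], the
   value at 1 gives the claim; in [W P2], the value at 0 contradicts the choice of [k]. *)
have [] : I01 `<=` W P1 \/ I01 `<=` W P2.
- apply: connected_subset => //; last exact: segment_connected.
  by split; rewrite -(closure_id _).1.
- move=> h; have I1 : I01 1 by rewrite /I01 /= in_itv /= ler01 lexx.
  by have [S /eqP Sk Sw] := countW _ _ _ (h _ I1) pw; rewrite -Sw Sk.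
- move=> h; have I0 : I01 0 by rewrite /I01 /= in_itv /= ler01 lexx.
  by have [S /eqP Sk Sv] := countW _ _ _ (h _ I0) pv; case: Sk.
Qed.

End RootCount.

(** * Continuity and compactness over the complex numbers *)

Lemma det_continuous (T : topologicalType) (K : numFieldType) n (A : T -> 'M[K]_n) :
  (forall i j, continuous (fun t => A t i j)) -> continuous (fun t => \det (A t)).
Proof.
move=> cA; rewrite /determinant.
apply: continuous_big => [|s _ t]; first exact: add_continuous.
apply: cvgMl_tmp; move: t.
by apply: continuous_big => [|i _]; [exact: mul_continuous | exact: cA].
Qed.

(** The norm of [K] takes values in [K] and that of the codomain in [R]; [d] carries real tolerances
    into [K]. *)
Lemma continuous_of_modulus (R : realType) (K : numFieldType) (f : K -> R)
    (d : R -> K) :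
  (forall e, 0 < e -> 0 < d e) ->
  (forall z w e, `|z - w| < d e -> `|f z - f w| < e) -> continuous f.
Proof.
move=> d0 fd z.
have ? : Filter (nbhs (z : K)) by exact: nbhs_filter.
apply/cvgrPdist_lt => e e0.
have : nbhs z (ball z (d e)) by apply: nbhsx_ballx; exact: d0.
by apply: filterS => w; exact: fd.
Qed.

Section ComplexTopology.
Variable R : realType.
Local Notation C := (Num.NumField.sort (R[i] : numFieldType)).


Lemma real_complex_continuous : continuous (fun t : R => t%:C : C).
Proof.
move=> t; apply/cvgrPdist_lt => /= e e0.
have er : e = (normc e)%:C by rewrite -normr_normc gtr0_norm.
have e0' : 0 < normc e by rewrite -ltcR -er.
near=> s; rewrite -rmorphB normr_normc normc_real er ltcR.
by near: s; apply: cvgr_dist_lt.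
Unshelve. all: by end_near. Qed.

Lemma normcB_continuous (a : C) : continuous (fun z : C => normc (z - a)).
Proof.
apply: (@continuous_of_modulus _ (R[i] : numFieldType) _ (real_complex R)) =>
  [e e0|z w e].
  by rewrite ltcR.
rewrite normr_normc ltcR; apply: le_lt_trans.
rewrite ler_norml lerBrDr addrC lerBlDr.
have := ler_normcD (z - w) (w - a).
have := ler_normcD (w - z) (z - a); rewrite !subrKA.
have -> : normc (w - z) = normc (z - w).
  by apply: complexI; rewrite -!normr_normc distrC.
by move=> *; apply/andP; split; lra.
Qed.

(** The disc is closed and lies in the image of a compact real square under [(x, y) |-> x + i y]. *)
Lemma compact_disc (a : C) (r : R) : compact [set z : C | normc (z - a) <= r].
Proof.
pose f (u : R * R) : C := u.1%:C + 'i * u.2%:C.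
have cf : continuous f.
  move=> u; apply: cvgD; last apply: cvgMl_tmp.
    by apply: (@cvg_comp _ _ _ fst); [exact: cvg_fst|exact: real_complex_continuous].
  by apply: (@cvg_comp _ _ _ snd); [exact: cvg_snd|exact: real_complex_continuous].
pose I (x : R) : set R := [set` `[x - r, x + r]].
apply: (@subclosed_compact _ _ (f @` (I (complex.Re a) `*` I (complex.Im a)))).
- have -> : [set z : C | normc (z - a) <= r] =
      (fun z => normc (z - a)) @^-1` [set x | x <= r] by [].
  by apply: closed_comp => [z _|]; [exact: normcB_continuous|exact: closed_le].
- apply: continuous_compact; first exact: continuous_subspaceT.
  by apply: compact_setX; exact: segment_compact.
move=> [x y]; case: a => [a b] /= h; exists (x, y); last first.
  by rewrite /f /=; apply/eqP; rewrite eq_complex /=; apply/andP; split; apply/eqP; ring.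
have r0 : 0 <= r by apply: le_trans h; exact: sqrtr_ge0.
have {}h : (x - a) ^+ 2 + (y - b) ^+ 2 <= r ^+ 2.
  move: h; rewrite -(@ler_pXn2r _ 2) ?nnegrE ?sqrtr_ge0//.
  by rewrite sqr_sqrtr ?addr_ge0 ?sqr_ge0.
have lex (s s' t t' : R) : (s - s') ^+ 2 + (t - t') ^+ 2 <= r ^+ 2 -> I s' s.
  move=> h'; rewrite /I /= in_itv /= -ler_distl distrC.
  rewrite -(@ler_pXn2r _ 2) ?nnegrE//.
  rewrite distrC real_normK ?num_real//; apply: le_trans h'.
  by rewrite lerDl sqr_ge0.
by split=> /=; [exact: lex h|apply: lex; rewrite addrC; exact: h].
Qed.

Lemma pencil_continuous n (M F : 'M[R[i]]_n) (z : C) :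
  continuous (fun t : R => (char_poly (M + t%:C *: F)).[z] : C).
Proof.
have -> : (fun t : R => (char_poly (M + t%:C *: F)).[z] : C) =
    fun t : R => \det (z%:M - (M + t%:C *: F)).
  by apply/funext => t; rewrite horner_char_poly.
apply: (@det_continuous R (R[i] : numFieldType)) => i j t.
have -> : (fun t : R => (z%:M - (M + t%:C *: F)) i j : C) =
    fun t : R => (z%:M - M) i j - t%:C * F i j.
  by apply/funext => s; rewrite !mxE opprD addrA.
apply: cvgB; first exact: cvg_cst.
by apply: cvgMr_tmp; exact: real_complex_continuous.
Qed.

End ComplexTopology.

(** * Perturbation of spectra *)

Section SpectrumPerturbation.
Variables (R : realType) (n : nat).
Implicit Types (lam lamt : 'I_n -> R[i]) (J S : {set 'I_n}).

Lemma subspectrum_setP lam S (z : Rcomplex R) :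
  subspectrum_set lam S z <-> exists2 j, j \in S & z = lam j.
Proof. by split=> [/fintype.imageP|h]; [|apply/fintype.imageP]. Qed.

Lemma finite_subspectrum_set lam S : finite_set (subspectrum_set lam S).
Proof. exact: finite_seq. Qed.

Lemma subspectrum_set_neq0 lam S : S != finset.set0 ->
  subspectrum_set lam S !=set0.
Proof. by case/set0Pn => j jS; exists (lam j); apply/subspectrum_setP; exists j. Qed.

Lemma subspectrum_setUC lam J :
  subspectrum_set lam J `|` subspectrum_set lam (~: J) =
  subspectrum_set lam [set: 'I_n]%SET.
Proof.
apply/seteqP; split=> z.
  by move=> [] /subspectrum_setP[j _ ->]; apply/subspectrum_setP; exists j.
move=> /subspectrum_setP[j _ ->]; have [jJ|jJ] := boolP (j \in J).
  by left; apply/subspectrum_setP; exists j.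
by right; apply/subspectrum_setP; exists j; rewrite // inE.
Qed.

Lemma set_dist_subspectrum lam S (z : Rcomplex R) :
  set_dist z (subspectrum_set lam S) =
  minimum [set` S] (fun j => normc ((z : R[i]) - lam j)).
Proof.
rewrite /set_dist /minimum; congr inf; apply/seteqP; split=> r.
  by move=> [_ /subspectrum_setP[j jS ->] <-]; exists j => //; rewrite metric_sym.
move=> [j jS <-]; exists (lam j); first by apply/subspectrum_setP; exists j.
by rewrite metric_sym.
Qed.

(** Links the definition by indices, which counts multiplicity, with the metric one on point
    sets. *)
Lemma closest_near_part lam lamt J i :
  i \in closest lam lamt J <->
  near_part (subspectrum_set lam J) (subspectrum_set lam (~: J))
    (subspectrum_set lamt [set: 'I_n]%SET) (lamt i).
Proof.
have setTE : [set` [set: 'I_n]%SET] = [set: 'I_n].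
  by apply/seteqP; split=> // k _; rewrite /= inE.
rewrite /near_part /= subspectrum_setUC !set_dist_subspectrum setTE inE.
split=> [/eqP iJ|[_ ->]//].
by split=> //; apply/subspectrum_setP; exists i.
Qed.

Lemma subspectrum_closest lam lamt J :
  subspectrum_set lamt (closest lam lamt J) =
  near_part (subspectrum_set lam J) (subspectrum_set lam (~: J))
    (subspectrum_set lamt [set: 'I_n]%SET).
Proof.
apply/seteqP; split=> z.
  by move=> /subspectrum_setP[i /closest_near_part ? ->].
move=> zJ; have /subspectrum_setP[i _ zi] := zJ.1.
by apply/subspectrum_setP; exists i => //; apply/closest_near_part; rewrite -zi.
Qed.

(** * Counting eigenvalues across a spectral gap *)

Section Gap.
Variables (lam : 'I_n -> R[i]) (e : R) (J : {set 'I_n}).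
Hypothesis gap :
  2 * e < sep (subspectrum_set lam J) (subspectrum_set lam (~: J)).

(** Typed over the numeric field, whose norm topology serves for compactness, whereas the spectra
    live in the metric space [Rcomplex R]. *)
Definition discs S : set (R[i] : numFieldType) :=
  [set z | exists2 j, j \in S & normc (z - lam j) <= e].

Lemma compact_discs S : compact (discs S).
Proof.
have -> : discs S = \bigcup_(j in [set` S]) [set z | normc (z - lam j) <= e].
  by apply/seteqP; split=> z [j]; exists j.
by rewrite bigcup_pred; apply: bigsetU_compact => j _; exact: compact_disc.
Qed.

Lemma discs_disj z : discs J z -> discs (~: J) z -> False.
Proof.
move=> [j jJ zj] [k kJ zk].
apply: (near_part_disj (r := z : Rcomplex R) (finite_subspectrum_set lam J)
  (finite_subspectrum_set lam (~: J)) gap).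
- by apply/subspectrum_setP; exists j.
- by apply/subspectrum_setP; exists k; first exact: kJ.
- by rewrite metric_sym.
- by rewrite metric_sym.
Qed.

Hypotheses (J0 : J != finset.set0) (JC0 : (~: J)%SET != finset.set0).

Lemma closestP lamt i :
  (forall i, exists j, normc (lamt i - lam j) <= e) ->
  i \in closest lam lamt J <-> discs J (lamt i).
Proof.
move=> near; rewrite closest_near_part.
rewrite (near_partP (h := e) _ (finite_subspectrum_set _ _)
  (finite_subspectrum_set _ _) (subspectrum_set_neq0 _ J0)
  (subspectrum_set_neq0 _ JC0)) //; last first.
  move=> _ /subspectrum_setP[k _ ->]; rewrite subspectrum_setUC.
  have [j kj] := near k; exists (lam j); last by rewrite metric_sym.
  by apply/subspectrum_setP; exists j.
split=> [[_ [_ /subspectrum_setP[j jJ ->] ij]]|[j jJ ij]].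
  by exists j => //; rewrite -[normc _]mdist_complexE metric_sym.
split; first by apply/subspectrum_setP; exists i.
exists (lam j); first by apply/subspectrum_setP; exists j.
by rewrite metric_sym.
Qed.

(** [bauer_fike], applied to [M] and the perturbation [t F], confines the roots of the pencil to the
    two disjoint families of discs. The count in [discs J] is therefore the same at both ends:
    [#|J|] at 0, and by [closestP] the left-hand side at 1. *)
Lemma card_closest (M F : 'M[R[i]]_n) lamt :
  M \is normalmx -> eigenvalues_of M lam -> eigenvalues_of (M + F) lamt ->
  (forall x, norm2 (F *m x) <= e * norm2 x) ->
  #|closest lam lamt J| = #|J|.
Proof.
move=> nM lamE lamtE Fe.
have tFe (t : R) x : `[0, 1]%classic t ->
    norm2 ((t%:C *: F) *m x) <= e * norm2 x.
  rewrite /= in_itv /= => /andP[t0 t1].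
  rewrite -scalemxAl norm2Z normc_real ger0_norm//.
  by apply: le_trans (Fe x); rewrite ler_piMl// norm2_ge0.
have near t mu : `[0, 1]%classic t -> \det (mu%:M - (M + t%:C *: F)) = 0 ->
    exists j, normc (mu - lam j) <= e.
  by move=> It; apply: (bauer_fike nM lamE) => x; exact: tFe.
have I0 : (`[0, 1]%classic : set R) 0 by rewrite /= in_itv /= lexx ler01.
have I1 : (`[0, 1]%classic : set R) 1 by rewrite /= in_itv /= lexx ler01.
have M0 : M + 0%:C *: F = M by rewrite scale0r addr0.
have M1 : M + 1%:C *: F = M + F by rewrite scale1r.
have near1 i : exists j, normc (lamt i - lam j) <= e.
  by apply: (near 1) => //; rewrite M1; apply/(eigenvalues_ofP _ lamtE); exists i.
(* At [t = 0] an eigenvalue of [M] is within [e] of the spectrum; this sign puts each [lam j] in its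
   own disc. *)
have e0 : 0 <= e.
  have /set0Pn[j _] := J0.
  have [|k] := near 0 (lam j) I0.
    by rewrite M0; apply/(eigenvalues_ofP _ lamE); exists j.
  by apply: le_trans; exact: normc_ge0.
have jdisc S j : j \in S -> discs S (lam j).
  by move=> jS; exists j; rewrite // subrr -[0]/(0%:C) normc_real normr0.
have discU z : (exists j, normc (z - lam j) <= e) -> discs J z \/ discs (~: J) z.
  move=> [j zj]; have [jJ|jJ] := boolP (j \in J); first by left; exists j.
  by right; exists j; rewrite // inE.
have djc : discs J `&` discs (~: J) = set0.
  by apply/seteqP; split=> // z [zJ zJC]; exact: (discs_disj zJ zJC).
have roots t : `[0, 1]%classic t -> exists u : 'I_n -> R[i],
    char_poly (M + t%:C *: F) = \prod_i ('X - (u i)%:P) /\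
    forall i, discs J (u i) \/ discs (~: J) (u i).
  move=> It; have [u uE] := exists_eigenvalues (M + t%:C *: F).
  exists u; split=> // i; apply: discU; apply: (near t) => //.
  by apply/(eigenvalues_ofP _ uE); exists i.
have := @root_count_const R (R[i] : numFieldType) n
  (fun t => char_poly (M + t%:C *: F)) (discs J) (discs (~: J))
  (fun z => @pencil_continuous R n M F z) (@compact_discs J) (@compact_discs (~: J))
  djc lam lamt roots.
rewrite M0 M1 => /(_ lamE lamtE).
move=> E; transitivity #|[set i | `[< discs J (lamt i) >]]%SET|.
  apply: eq_card => i; rewrite [RHS]inE.
  by apply/idP/asboolP => [h|h]; [apply/(closestP i near1)|apply/(closestP i near1)].
(* An index outside [J] would place [lam i] in both families. *)
rewrite -E; apply: eq_card => i; rewrite inE; apply/asboolP/idP => [iJ|/jdisc//].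
apply: contrapT => /negP niJ; apply: (discs_disj iJ).
by apply: jdisc; rewrite inE.
Qed.

End Gap.

End SpectrumPerturbation.

(** * Separation and multiplicities for normal matrices *)

Theorem lemma7 (R : realType) (n : nat) (M Mt : 'M[R[i]]_n)
    (lam lamt : 'I_n -> R[i]) (J : {set 'I_n})
    (hM : M \is normalmx) (hMt : Mt \is normalmx)
    (hlam : eigenvalues_of M lam) (hlamt : eigenvalues_of Mt lamt)
    (hJ0 : J != finset.set0) (hJT : J \proper [set: 'I_n]%SET)
    (hpert : opnorm2 (Mt - M) <
       1 / 2 * sep (subspectrum_set lam J) (subspectrum_set lam (~: J)%SET)) :
  let Jhat := closest lam lamt J in
  let Jhatc := closest lam lamt (~: J)%SET in
  (sep_preserving (subspectrum_set lam J) (subspectrum_set lam (~: J)%SET)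
     (subspectrum_set lamt [set: 'I_n]%SET)
     (subspectrum_set lamt Jhat) (subspectrum_set lamt Jhatc) /\
   sep (subspectrum_set lamt Jhat) (subspectrum_set lamt Jhatc) >=
     sep (subspectrum_set lam J) (subspectrum_set lam (~: J)%SET)
     - 2 * opnorm2 (Mt - M)) /\
  (size (subspectrum lamt Jhat) = size (subspectrum lam J) /\
   size (subspectrum lamt Jhatc) = size (subspectrum lam (~: J)%SET)).
Proof.
move=> Jhat Jhatc.
set e := opnorm2 (Mt - M) in hpert *.
set P := subspectrum_set lam J in hpert *.
set Q := subspectrum_set lam (~: J)%SET in hpert *.
set S := subspectrum_set lamt [set: 'I_n]%SET.
have gap : 2 * e < sep P Q by move: hpert; lra.
have JC0 : (~: J)%SET != finset.set0.
  move: hJT; rewrite properT; apply: contra_neq => /(congr1 (@finset.setC _)).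
  by rewrite finset.setCK finset.setC0.
have N0 : [set: 'I_n]%SET != finset.set0.
  by case/set0Pn: hJ0 => j _; apply/set0Pn; exists j; rewrite inE.
have PQE : P `|` Q = subspectrum_set lam [set: 'I_n]%SET by exact: subspectrum_setUC.
have MtE : Mt + (M - Mt) = M by rewrite addrC subrK.
have ME : M + (Mt - M) = Mt by rewrite addrC subrK.
have Fe x : norm2 ((Mt - M) *m x) <= e * norm2 x by exact: opnorm2P.
have hPQ : hausdorff_dist (P `|` Q) S <= e.
  rewrite PQE; apply/(hausdorff_dist_le _ (finite_subspectrum_set _ _)
    (finite_subspectrum_set _ _) (subspectrum_set_neq0 _ N0) (subspectrum_set_neq0 _ N0)).
  split=> _ /subspectrum_setP[i _ ->].
    (* Here [M] is the perturbation of the normal matrix [Mt]; the opposite difference obeys the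
       same bound [e]. *)
    have [||j] := @bauer_fike R n Mt (M - Mt) lamt e (lam i) hMt hlamt.
    - by move=> x; rewrite -opprB mulNmx norm2N.
    - by rewrite MtE; apply/(eigenvalues_ofP _ hlam); exists i.
    by exists (lamt j) => //; apply/subspectrum_setP; exists j.
  have [|j] := @bauer_fike R n M (Mt - M) lam e (lamt i) hM hlam Fe.
    by rewrite ME; apply/(eigenvalues_ofP _ hlamt); exists i.
  exists (lam j); first by apply/subspectrum_setP; exists j.
  by rewrite metric_sym.
have PE : subspectrum_set lamt Jhat = near_part P Q S by exact: subspectrum_closest.
have QE : subspectrum_set lamt Jhatc = near_part Q P S.
  by rewrite /Jhatc subspectrum_closest finset.setCK.
have sp : sep_preserving P Q S (near_part P Q S) (near_part Q P S).
  apply: sep_preserving_finite (finite_subspectrum_set _ _)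
    (finite_subspectrum_set _ _) (finite_subspectrum_set _ _)
    (subspectrum_set_neq0 _ hJ0) (subspectrum_set_neq0 _ JC0)
    (subspectrum_set_neq0 _ N0) _.
  by rewrite -/P -/Q -/S; move: hPQ gap; lra.
(* Stated for any [K], to be used for [J] and for its complement. *)
have card (K : {set 'I_n}) : K != finset.set0 -> (~: K)%SET != finset.set0 ->
    2 * e < sep (subspectrum_set lam K) (subspectrum_set lam (~: K)) ->
    size (subspectrum lamt (closest lam lamt K)) = size (subspectrum lam K).
  move=> K0 KC0 gapK; rewrite /subspectrum !size_image.
  by apply: (card_closest gapK K0 KC0 hM hlam _ Fe); rewrite ME.
split; last first.
  by split; apply: card; rewrite ?finset.setCK// sepC.
rewrite PE QE; split=> //.
(* [sp_sep] gives the bound with the Hausdorff distance, which is at most [e]. *)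
by have := sp_sep sp; move: hPQ; lra.
Qed.
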